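(* Let $N \geq 1$ be an integer, let $x_1, \dots, x_N \in \mathbb{T}$, and put $$ A = \frac{2}{N}\int_{0}^{N/2} \left| \frac{1}{N}\, \# \left\{ (m,n): 1 \leq m, n \leq N,\ m \neq n,\ |x_m - x_n| \leq \frac{s}{N} \right\} - 2s \right|^2 ds . $$ Then $$ A \leq \pi^{-2} F_{N^2}\left(\left\{x_n - x_m : 1 \leq n, m \leq N\right\}\right)^2 + 1, $$ where $F_{N^2}$ is the diaphony of the family of $N^2$ differences $x_n - x_m$, $1 \leq n,m \leq N$.
   Context: $\mathbb{T} = \mathbb{R}/\mathbb{Z}$ is the one-dimensional torus, identified with $[0,1]$ with endpoints glued. For $x,y \in \mathbb{T}$, $|x-y|$ denotes the distance on the torus, i.e. the distance from $x-y$ to the nearest integer. Pairs $(m,n)$ are ordered. The diaphony of a finite family $y_1,\dots,y_M$ of points in $\mathbb{T}$ (counted with multiplicity) is, in the normalization used here, $$ F_M(\{y_1,\dots,y_M\}) = \left( 2 \sum_{k=1}^{\infty} \frac{1}{k^2} \left| \sum_{j=1}^{M} e^{2\pi i k y_j} \right|^2 \right)^{1/2}. $$ The family of differences $\{x_n - x_m : 1 \leq n,m \leq N\}$ is indexed by all ordered pairs $(n,m)$, including $n=m$, so it has $N^2$ members counted with multiplicity. *)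

(* Defs.v *)
From HB Require Import structures.
From mathcomp Require Import all_boot all_order all_algebra.
From mathcomp Require Import generic_quotient ring_quotient complex.
From mathcomp Require Import all_classical all_reals all_analysis.

Set Implicit Arguments.
Unset Strict Implicit.
Unset Printing Implicit Defensive.

Import Order.TTheory GRing.Theory Num.Theory.
Import numFieldNormedType.Exports.

Local Open Scope classical_set_scope.
Local Open Scope quotient_scope.
Local Open Scope ring_scope.

Section Torus.
Variable R : realType.

(* [Num.int_num_subdef] is the predicate underlying the qualifier [Num.int],
   so [torus] is the additive group R / Z. *)
Definition int_subgroup : zmodClosed R :=
  GRing.ZmodClosed.clone R (@Num.int_num_subdef R) _.

Definition torus := Quotient.quot int_subgroup.

Definition dist_int (r : R) : R := inf [set `|r - k%:~R| | k in [set: int]].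

(* [tnorm] and [echar] use an arbitrary representative; [tnorm_pi] and
   [echar_pi] show that its choice is immaterial. *)
Definition tnorm (z : torus) : R := dist_int (repr z).

(* e^(i t); there is no library complex exponential on [R[i]]. *)
Definition expi (t : R) : R[i] := (cos t +i* sin t)%C.

Definition echar (k : nat) (z : torus) : R[i] := expi (2 * pi * k%:R * repr z).

Lemma torus_eqP (r s : R) :
  reflect (\pi_torus r = \pi_torus s) (r - s \is a Num.int).
Proof.
rewrite [_ \is a _](Quotient.idealrBE int_subgroup).
exact: eqP.
Qed.

Lemma torus_piB (r s : R) : \pi_torus (r - s) = \pi_torus r - \pi_torus s.
Proof. by rewrite !piE. Qed.

Lemma repr_piE (r : R) : exists m : int, repr (\pi_torus r) = r + m%:~R.
Proof.
have /torus_eqP/intrP[m Hm] : \pi_torus (repr (\pi_torus r)) = \pi_torus r.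
  by rewrite reprK.
by exists m; rewrite -Hm addrC subrK.
Qed.

Lemma dist_intDz (r : R) (m : int) : dist_int (r + m%:~R) = dist_int r.
Proof.
rewrite /dist_int; congr inf; apply/seteqP; split => _ [k _ <-].
  by exists (k - m) => //; rewrite intrB opprB addrA addrAC.
by exists (k + m) => //; rewrite intrD opprD addrACA addrAC subrr addr0.
Qed.

Lemma tnorm_pi (r : R) : tnorm (\pi_torus r) = dist_int r.
Proof. by rewrite /tnorm; have [m ->] := repr_piE r; rewrite dist_intDz. Qed.

Lemma periodicz (f : R -> R) (T : R) :
  periodic f T -> forall (n : int) a, f (a + T * n%:~R) = f a.
Proof.
move=> fT [n|n] a; first by rewrite -pmulrn mulr_natr periodicn.
rewrite -[in RHS](subrK (T *+ n.+1) a) periodicn //.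
by rewrite NegzE mulrNz -pmulrn mulrN mulr_natr.
Qed.

Lemma echar_pi (k : nat) (r : R) :
  echar k (\pi_torus r) = expi (2 * pi * k%:R * r).
Proof.
rewrite /echar /expi; have [m ->] := repr_piE r.
have -> : 2 * pi * k%:R * (r + m%:~R) =
          2 * pi * k%:R * r + (pi *+ 2) * (k%:Z * m)%:~R :> R.
  by rewrite mulrDr intrM -pmulrn -[pi *+ 2]mulr_natl !mulrA.
by rewrite (periodicz (@cosD2pi R)) (periodicz (@sinD2pi R)).
Qed.

(* The norm [`|_|] on [R[i]] is [R[i]]-valued; [Normc.normc] is the real-valued
   modulus.  The partial sums converge, since the modulus is at most #|I|. *)
Definition diaphony (I : finType) (y : I -> torus) : R :=
  Num.sqrt (2 * \big[+%R/0]_(1 <= k <oo)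
    (k%:R ^- 2 * Normc.normc (\sum_(j : I) echar k (y j)) ^+ 2)).

End Torus.

(* Main.v *)
(** The count equals the number of all ordered pairs at distance at most [s/N]
    minus the [N] diagonal ones.  Writing [d_p] for the torus norms of the [N^2]
    differences, expanding the square and integrating gives
      [A = (2/N^2) sum_(p,q) K(d_p,d_q) - (4/N) sum_p (1/4 - d_p) + 1],
    with [K(a,b) = 1/6 - max(a,b) + a^2 + b^2].
    The Fourier series [f(t) = sum_k cos(k t)/k^2 = (t - pi)^2/4 - pi^2/12] on
    [[0, 2 pi]] is obtained up to a constant by applying the mean value theorem
    to its partial sums, and the constant follows from the duplication formula
    [f(t/2) + f(t/2 + pi) = f(t)/2].  Hence
      [K(a,b) = sum_k cos(2 pi k a) cos(2 pi k b) / (pi k)^2]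
    and [2 sum K <= F^2 / pi^2].  Also [1/4 - a] is a combination of the
    [cos(2 pi k a)], [k] odd, with positive coefficients, so [sum_p (1/4 - d_p)]
    is nonnegative because [sum_p cos(2 pi k d_p) = |sum_n e(k x_n)|^2].
    This even bounds [A] by [(F/(pi N))^2 + 1]. *)
Require Import Defs.
From mathcomp Require Import all_boot all_order all_algebra.
From mathcomp Require Import complex ring lra.
From mathcomp Require Import all_classical all_reals all_analysis.

Import Order.TTheory GRing.Theory Num.Theory.
Import numFieldNormedType.Exports.

Local Open Scope classical_set_scope.
Local Open Scope ring_scope.

(** * Trigonometric sums and their termwise derivatives *)

Lemma sin_natpi {R : realType} (n : nat) : sin (n%:R * pi : R) = 0.
Proof.
elim: n => [|n IH]; first by rewrite mul0r sin0.
by rewrite -natr1 mulrDl mul1r sinDpi IH oppr0.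
Qed.

(** Each [2 sin(t/2) cos(k t)] equals [sin((k+1/2) t) - sin((k-1/2) t)], so the sum telescopes.
    Keeping the sine factor on the left avoids a division by zero. *)
Lemma dirichlet_kernel {R : realType} (n : nat) (t : R) :
  2 * sin (t / 2) * \sum_(k < n) cos (k.+1%:R * t)
  = sin ((n%:R + 2^-1) * t) - sin (t / 2).
Proof.
elim: n => [|n IH].
  by rewrite big_ord0 mulr0 add0r [2^-1 * t]mulrC subrr.
rewrite big_ord_recr /= mulrDr IH.
have -> : (n%:R + 2^-1) * t = n.+1%:R * t + - (t / 2) by rewrite -natr1; field.
have -> : (n.+1%:R + 2^-1) * t = n.+1%:R * t + t / 2 by field.
rewrite !sinD sinN cosN; ring.
Qed.

Lemma is_derive_sin_lin {R : realType} (c t : R) :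
  is_derive t 1 (fun u => sin (c * u)) (c * cos (c * t)).
Proof.
have dl : is_derive t 1 (fun u : R => c * u) c.
  have := @is_deriveZ _ _ _ id c t 1 1 (is_derive_id _ _).
  by rewrite /GRing.scale /= mulr1.
have := @is_derive1_comp R sin (fun u => c * u) t (cos (c * t)) c
  (is_derive_sin _) dl.
by rewrite mulrC.
Qed.

Lemma is_derive_cos_lin {R : realType} (c t : R) :
  is_derive t 1 (fun u => cos (c * u)) (- (c * sin (c * t))).
Proof.
have dl : is_derive t 1 (fun u : R => c * u) c.
  have := @is_deriveZ _ _ _ id c t 1 1 (is_derive_id _ _).
  by rewrite /GRing.scale /= mulr1.
have := @is_derive1_comp R cos (fun u => c * u) t (- sin (c * t)) c
  (is_derive_cos _) dl.
by rewrite mulrC mulrN.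
Qed.

Lemma is_derive_bigsum {R : realType} (n : nat) (f : nat -> R -> R)
    (df : nat -> R) (t : R) :
  (forall k, is_derive t 1 (f k) (df k)) ->
  is_derive t 1 (fun u => \sum_(k < n) f k u) (\sum_(k < n) df k).
Proof.
move=> H.
have := @is_derive_sum _ _ _ n (fun k : 'I_n => f k) t 1 (fun k : 'I_n => df k)
  (fun k => H k).
by congr (is_derive _ _ _ _); apply/funext => u; rewrite fct_sumE.
Qed.

Lemma mvt_bound {R : realType} (f df : R -> R) (a b K : R) : a <= b ->
  (forall t, a <= t <= b -> is_derive t 1 f (df t)) ->
  (forall t, a <= t <= b -> `|df t| <= K) ->
  `|f b - f a| <= K * (b - a).
Proof.
move=> ab H HK.
have [|c|c cab ->] := @MVT_segment R f df a b ab.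
- by move=> t; rewrite in_itv /= => /andP[/ltW ? /ltW ?]; apply: H; lra.
- apply: derivable_within_continuous => t; rewrite in_itv /= => tab.
  by have [] := H _ tab.
- rewrite normrM [`|b - a|]ger0_norm ?subr_ge0//.
  by apply: ler_wpM2r; [lra | apply: HK; move: cab; rewrite in_itv].
Qed.

(** * Convergence of the sawtooth series away from 0 *)

(** The Fourier series [sum sin(k t)/k] has the value [(pi - t)/2] on the open interval from 0 to
    [2 pi]; this is the error of its partial sum. *)
Definition sawtooth_err {R : realType} (n : nat) (t : R) : R :=
  \sum_(k < n) (k.+1%:R^-1 * sin (k.+1%:R * t)) - (pi - t) / 2.

Lemma is_derive_sawtooth_err {R : realType} (n : nat) (t : R) :
  is_derive t 1 (sawtooth_err n) (\sum_(k < n) cos (k.+1%:R * t) + 2^-1).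
Proof.
apply: is_deriveD.
  have -> : \sum_(k < n) cos (k.+1%:R * t) =
     \sum_(k < n) (k.+1%:R^-1 * (k.+1%:R * cos (k.+1%:R * t))).
    by apply: eq_bigr => k _; rewrite mulrA mulVf ?mul1r ?pnatr_eq0.
  apply: (@is_derive_bigsum _ n (fun k u => k.+1%:R^-1 * sin (k.+1%:R * u))
    (fun k => k.+1%:R^-1 * (k.+1%:R * cos (k.+1%:R * t)))) => k.
  exact: (@is_deriveZ _ _ _ _ (k.+1%:R^-1) t 1 _ (is_derive_sin_lin _ _)).
have := @is_derive_poly R (2^-1%:P * 'X - (pi / 2)%:P) t.
rewrite derivB derivM !derivC derivX mul0r add0r subr0 mulr1 hornerC.
congr (is_derive _ _ _ _); apply/funext => u; rewrite !hornerE /=.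
by field.
Qed.

(** The derivative of the error is [sin((n+1/2) t) / (2 sin(t/2))]. Its oscillation gains a factor
    [1/n], by an integration by parts disguised as the mean value theorem. Staying above [a] keeps
    [sin(t/2)] away from 0. *)
Lemma sawtooth_err_bound {R : realType} (a : R) : 0 < a -> a <= pi ->
  {K : R | forall n t, a <= t <= pi -> `|sawtooth_err n t| <= K / n.+1%:R}.
Proof.
move=> a0 api.
set sg := sin (a / 2).
have pi0 : 0 < pi :> R := pi_gt0 R.
have sg0 : 0 < sg by apply: sin_gt0_pi; lra.
have sgle t : a <= t <= pi -> sg <= sin (t / 2).
  move=> at_; rewrite /sg; move/andP: at_ => [at_ tpi].
  rewrite leNgt ltr_sin ?in_itv /=; [by rewrite -leNgt; lra | lra | lra].
(* Up to the factor [(2 * c)^-1 = 1/(2n+1) <= 1/(n+1)], the first term bounds the increment of [h]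
   over a length at most [pi], and the second bounds the added term at [pi] and at [t]. *)
exists (pi / sg ^+ 2 + 2 / sg) => n t atpi.
pose c : R := n%:R + 2^-1.
have c0 : 0 < c by rewrite /c ltr_wpDl ?ler0n ?invr_gt0.
(* The added term is O(1/n), and its derivative cancels the Dirichlet kernel
   [sin (c u) / (2 sin (u/2))] up to O(1/n). *)
pose h u : R :=
  sawtooth_err n u + (2 * c)^-1 * (cos (c * u) * (sin (2^-1 * u))^-1).
pose dh u : R := - ((2 * c)^-1 * cos (c * u) *
  (2^-1 * cos (2^-1 * u)) * (sin (2^-1 * u))^-2).
have sin0 u : a <= u <= pi -> sin (2^-1 * u) != 0.
  by move=> aup; rewrite mulrC gt_eqF// (lt_le_trans sg0)// sgle.
have dhE u : a <= u <= pi -> is_derive u 1 h (dh u).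
  move=> aup; rewrite /h.
  have dV := is_deriveV (sin0 u aup) (is_derive_sin_lin 2^-1 u).
  have dM := is_deriveM (is_derive_cos_lin c u) dV.
  have dZ := is_deriveZ (2 * c)^-1 dM.
  apply: is_derive_eq (is_deriveD (is_derive_sawtooth_err n u) dZ) _.
  have := dirichlet_kernel n u; rewrite -/c [u / 2]mulrC.
  move=> D; have s0 := sin0 u aup.
  have -> : \sum_(k < n) cos (k.+1%:R * u) =
      (sin (c * u) - sin (2^-1 * u)) / (2 * sin (2^-1 * u)).
    rewrite -D; field; exact: s0.
  rewrite /dh /GRing.scale /=; field.
  by rewrite s0 gt_eqF.
have sinV u : a <= u <= pi -> 0 < (sin (2^-1 * u))^-1 <= sg^-1.
  move=> aup; have := sgle u aup; rewrite [u / 2]mulrC => sl.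
  rewrite invr_gt0 (lt_le_trans sg0 sl)/=.
  by rewrite lef_pV2 ?posrE ?(lt_le_trans sg0 sl).
have cV : 0 < (2 * c)^-1 <= n.+1%:R^-1.
  rewrite invr_gt0 mulr_gt0//= lef_pV2 ?posrE ?mulr_gt0//.
  by rewrite /c -natr1; have := ler0n R n; lra.
have cosb (u : R) : `|cos u| <= 1 by rewrite ler_norml cos_geN1 cos_le1.
set e := (2 * c)^-1 in cV h dh dhE *.
have Zb u : a <= u <= pi ->
    `|e * (cos (c * u) * (sin (2^-1 * u))^-1)| <= e / sg.
  move=> aup; have /andP[s0 s1] := sinV u aup; have /andP[e0 _] := cV.
  rewrite normrM gtr0_norm// ler_pM2l// normrM [X in _ * X]gtr0_norm//.
  by rewrite -[leRHS]mul1r ler_pM// ltW.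
have dhb u : a <= u <= pi -> `|dh u| <= e * sg ^- 2.
  move=> aup; have /andP[s0 s1] := sinV u aup; have /andP[e0 _] := cV.
  rewrite /dh normrN !normrM gtr0_norm// -exprVn.
  rewrite [X in _ <= _ * X](_ : _ = sg^-1 ^+ 2); last by rewrite exprVn.
  rewrite -[leLHS]mulrA -[leLHS]mulrA ler_pM2l//.
  rewrite normrX [`|_^-1|]gtr0_norm//.
  rewrite mulrA -[leRHS]mul1r ler_pM ?mulr_ge0//.
    rewrite -[leRHS]mul1r ler_pM ?mulr_ge0//.
    by have := cosb (2^-1 * u); lra.
  by rewrite [`|_^-1|]gtr0_norm// !expr2 ler_pM// ltW.
have /andP[t1 t2] := atpi.
have B : `|h pi - h t| <= e * sg ^- 2 * (pi - t).
  by apply: (mvt_bound _ dh) => // u tu; [apply: dhE|apply: dhb]; lra.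
(* The error vanishes at [pi], which anchors the mean value estimate there. *)
have gpi : sawtooth_err n pi = 0 :> R.
  rewrite /sawtooth_err subrr mul0r subr0 big1// => k _.
  by rewrite sin_natpi mulr0.
have Zt := Zb t atpi.
have Zp : `|e * (cos (c * pi) * (sin (2^-1 * pi))^-1)| <= e / sg.
  by apply: Zb; lra.
have B2 : e * sg ^- 2 * (pi - t) <= e * sg ^- 2 * pi.
  have /andP[e0 _] := cV.
  by rewrite ler_pM2l ?mulr_gt0 ?invr_gt0 ?exprn_gt0//; lra.
have E : sawtooth_err n t = - (h pi - h t) +
    (e * (cos (c * pi) * (sin (2^-1 * pi))^-1)) -
    e * (cos (c * t) * (sin (2^-1 * t))^-1).
  by rewrite /h gpi; ring.
rewrite E.
apply: (@le_trans _ _ (e * (pi / sg ^+ 2 + 2 / sg))).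
  apply: le_trans (ler_normB _ _) _.
  apply: le_trans (lerD (ler_normD _ _) (lexx _)) _.
  rewrite normrN; lra.
rewrite mulrC ler_pM2l; first by have /andP[] := cV.
by rewrite addr_gt0// divr_gt0// ?exprn_gt0.
Qed.

(** * Closed form of the cosine series *)

Definition cos_series {R : realType} (t : R) : R^nat :=
  [series k.+1%:R ^- 2 * cos (k.+1%:R * t)]_k.

Lemma is_cvg_inv_sqr {R : realType} : cvgn [series (k.+1%:R ^- 2 : R)]_k.
Proof.
apply: nondecreasing_is_cvgn.
  by apply: nondecreasing_series => k _ _; rewrite invr_ge0 exprn_ge0.
(* The bound 2 alone is not inductive. With [a = n + 1], the sharper one grows by [2/a - 2/(a+1)],
   which is at least [1/a^2] since [a >= 1]. *)
exists 2 => _ [n _ <-]; apply: (@le_trans _ _ (2 - 2 / n.+1%:R)); last first.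
  by rewrite gerBl divr_ge0.
rewrite /series /=; elim: n => [|n IH]; first by rewrite big_geq// divr1 subrr.
rewrite big_nat_recr//=; apply: le_trans (lerD IH (lexx _)) _.
rewrite -subr_ge0 -[n.+2%:R]natr1; set a : R := n.+1%:R.
have a1 : 1 <= a by rewrite /a ler1n.
rewrite (_ : _ - _ = (a - 1) / (a ^+ 2 * (a + 1))).
  by rewrite divr_ge0 ?mulr_ge0 ?exprn_ge0//; lra.
by field; apply/andP; split; apply/eqP; lra.
Qed.

Lemma is_cvg_cos_series {R : realType} (t : R) : cvgn (cos_series t).
Proof.
apply: normed_cvg; apply: series_le_cvg is_cvg_inv_sqr => //= k.
rewrite normrM ger0_norm ?invr_ge0 ?exprn_ge0//.
by rewrite ler_piMr ?invr_ge0 ?exprn_ge0// ler_norml cos_geN1 cos_le1.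
Qed.

(** The parabola is the expected limit up to a constant; subtracting it leaves a derivative that
    tends to 0 on each [[a, pi]] with [a > 0]. *)
Lemma is_derive_cos_series {R : realType} (n : nat) (t : R) :
  is_derive t 1 (fun u => cos_series u n - (u - pi) ^+ 2 / 4)
    (- sawtooth_err n t).
Proof.
have -> : - sawtooth_err n t =
   \sum_(k < n) (- (k.+1%:R^-1 * sin (k.+1%:R * t))) - (t - pi) / 2.
  by rewrite /sawtooth_err sumrN; field.
apply: is_deriveD.
  have := @is_derive_bigsum _ n (fun k u => k.+1%:R ^- 2 * cos (k.+1%:R * u))
    (fun k => - (k.+1%:R^-1 * sin (k.+1%:R * t))) t.
  rewrite (_ : (fun u => cos_series u n) =
    (fun u => \sum_(k < n) k.+1%:R ^- 2 * cos (k.+1%:R * u))); last first.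
    by apply/funext => u; rewrite /cos_series /series /= big_mkord.
  apply=> k.
  apply: is_derive_eq
    (@is_deriveZ _ _ _ _ (k.+1%:R^-2) t 1 _ (is_derive_cos_lin _ _)) _.
  by rewrite /GRing.scale/=; field; rewrite addrC natr1 pnatr_eq0.
pose p : {poly R} := - (4^-1%:P * ('X - pi%:P) ^+ 2).
rewrite (_ : (fun u => - ((u - pi) ^+ 2 / 4)) = horner p); last first.
  apply/funext => u; rewrite /p !hornerE expr2; congr (- _).
  exact: (etrans (mulrC _ _) (mulrA _ _ _)).
apply: is_derive_eq (is_derive_poly p t) _.
rewrite /p derivN derivM derivC mul0r add0r expr2 derivM derivB derivX derivC.
by rewrite !hornerE; field.
Qed.

(** Between [a] and [pi], the partial sum minus the parabola changes by at most [K (pi - a)/(n+1)],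
    so the limit minus the parabola takes the same value at both points. *)
Lemma cos_series_dist_pi {R : realType} (a : R) : 0 < a -> a <= pi ->
  limn (cos_series a) = limn (cos_series pi) + (a - pi) ^+ 2 / 4.
Proof.
move=> a0 api; have [K HK] := sawtooth_err_bound a a0 api.
pose q u : R := (u - pi) ^+ 2 / 4.
have main n : `|(cos_series pi n - q pi) - (cos_series a n - q a)| <=
    K * (pi - a) * harmonic n.
  rewrite [leRHS]mulrAC.
  apply: (mvt_bound (fun u => cos_series u n - q u)
    (fun u => - sawtooth_err n u)) => //.
    by move=> u _; exact: is_derive_cos_series.
  by move=> u au; rewrite normrN; apply: HK.
have q0 : q pi = 0 by rewrite /q subrr expr0n mul0r.
have cv : (cos_series pi n - q pi) - (cos_series a n - q a) @[n --> \oo] --> (0 : R).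
  apply/norm_cvg0P; apply: (@squeeze_cvgr _ _ _ _ (cst 0)
    (fun n => K * (pi - a) * harmonic n)).
  - by near=> n; rewrite normr_ge0/=; exact: main.
  - exact: cvg_cst.
  - rewrite -[0 in X in _ --> X](mulr0 (K * (pi - a))).
    by apply: cvgMr; exact: cvg_harmonic.
have cv2 : (cos_series pi n - q pi) - (cos_series a n - q a) @[n --> \oo] -->
   (limn (cos_series pi) - q pi) - (limn (cos_series a) - q a).
  by apply: cvgB; apply: cvgB; try exact: is_cvg_cos_series; exact: cvg_cst.
have := cvg_unique _ cv cv2; rewrite -/(q a) q0 => E.
have /= : 0 = limn (cos_series pi) - 0 - (limn (cos_series a) - q a) by apply: E.
lra.
Unshelve. all: by end_near. Qed.

Lemma cos_series_sym {R : realType} (a : R) :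
  cos_series (2 * pi - a) = cos_series a.
Proof.
apply/funext => n; apply: eq_bigr => k _; congr (_ * _).
have -> : k.+1%:R * (2 * pi - a) = - (k.+1%:R * a) + (pi *+ 2) * (k.+1%:Z)%:~R.
  by rewrite -pmulrn; ring.
by rewrite (periodicz (@cosD2pi R)) cosN.
Qed.

Lemma cosDnatpi {R : realType} (n : nat) (a : R) :
  cos (a + n%:R * pi) = (-1) ^+ n * cos a.
Proof.
elim: n => [|n IH]; first by rewrite mul0r addr0 expr0 mul1r.
by rewrite -natr1 mulrDl mul1r addrA cosDpi IH exprS mulN1r mulNr.
Qed.

(** The shift by [pi] multiplies the [k]-th term by [(-1)^k]: odd terms cancel and [k = 2m]
    contributes [2 cos(m a)/(4 m^2)]. Hence partial sums of length [2n] on the left match those of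
    length [n] on the right exactly. *)
Lemma cos_series_dup {R : realType} (a : R) :
  limn (cos_series (a / 2)) + limn (cos_series (a / 2 + pi)) =
  limn (cos_series a) / 2.
Proof.
have E n : cos_series (a / 2) (n * 2)%N + cos_series (a / 2 + pi) (n * 2)%N =
    cos_series a n * 2^-1.
  elim: n => [|n IH].
    by rewrite /cos_series /series /= !big_geq ?mul0r ?addr0.
  move: IH; rewrite mulSn addnC addn2 /cos_series /series /=.
  rewrite !big_nat_recr//= => IH.
  rewrite [RHS]mulrDl -IH !(mulrDr _ (a / 2)) !cosDnatpi.
  have -> : (n * 2).+2%:R * (a / 2) = n.+1%:R * a.
    by rewrite -[(n * 2).+2]/(n.+1 * 2)%N natrM; field.
  rewrite !exprS exprM (exprAC _ _ 2) sqrrN expr1n expr1n.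
  rewrite -[(n * 2).+2]/(n.+1 * 2)%N natrM.
  have : n.+1%:R != 0 :> R by rewrite pnatr_eq0.
  have : (n * 2).+1%:R != 0 :> R by rewrite pnatr_eq0.
  move: (_.+1%:R) (n.+1%:R) => u v u0 v0.
  by field; apply/andP.
have c1 (b : R) : cos_series b (n * 2)%N @[n --> \oo] --> limn (cos_series b).
  by apply: cvg_comp (is_cvg_cos_series b); exact: cvg_mulnr.
have c2 : cos_series a n * 2^-1 @[n --> \oo] --> limn (cos_series a) * 2^-1.
  by apply: cvgMl; exact: is_cvg_cos_series.
have c3 : cos_series a n * 2^-1 @[n --> \oo] -->
    limn (cos_series (a / 2)) + limn (cos_series (a / 2 + pi)).
  by under eq_fun do rewrite -E; apply: cvgD; exact: c1.
by have := cvg_unique _ c3 c2; apply.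
Qed.

Lemma limn_cos_series {R : realType} (t : R) : 0 <= t -> t <= 2 * pi ->
  limn (cos_series t) = (t - pi) ^+ 2 / 4 - pi ^+ 2 / 12.
Proof.
move=> t0 t2; have pi0 := pi_gt0 R.
have main (u : R) : 0 < u -> u < 2 * pi ->
    limn (cos_series u) = limn (cos_series pi) + (u - pi) ^+ 2 / 4.
  move=> u0 u2; have [upi|piu] := leP u pi; first exact: cos_series_dist_pi.
  rewrite -cos_series_sym cos_series_dist_pi; [|lra|lra].
  by field.
(* With [main], duplication at [pi] is a linear equation for this value. *)
have cpi : limn (cos_series pi) = - (pi ^+ 2 / 12) :> R.
  have := cos_series_dup (pi : R).
  rewrite (main (pi / 2)) ?(main (pi / 2 + pi)); [|lra|lra|lra|lra].
  lra.
(* [main] excludes the endpoints; duplication at 0 reads [f(0) + f(pi) = f(0)/2], and symmetry then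
   covers [2 pi]. *)
have c0 : limn (cos_series 0) = pi ^+ 2 / 6 :> R.
  have := cos_series_dup (0 : R); rewrite mul0r add0r cpi; lra.
have [->|tn0] := eqVneq t 0; first by rewrite c0; field.
have [t2pi|tn2] := eqVneq t (2 * pi).
  by rewrite -cos_series_sym t2pi subrr c0; field.
by rewrite main ?cpi; [field|rewrite lt_neqAle eq_sym tn0|rewrite lt_neqAle tn2].
Qed.

(** * Integrals of step functions times polynomials *)

(** Linearity of the integral requires integrability, so both are carried together through sums and
    scalings. *)
Definition has_Rintegral {R : realType} (D : set R) (f : R -> R) (v : R) :=
  lebesgue_measure.-integrable D (EFin \o f) /\
  \int[lebesgue_measure]_(s in D) f s = v.

Lemma has_RintegralD {R : realType} (D : set R) (f g : R -> R) (v w : R) :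
  measurable D -> has_Rintegral D f v -> has_Rintegral D g w ->
  has_Rintegral D (fun s => f s + g s) (v + w).
Proof.
move=> mD [fi fv] [gi gv]; split; last by rewrite RintegralD// fv gv.
under [X in integrable _ _ X]eq_fun do rewrite /= EFinD.
exact: integrableD.
Qed.

Lemma has_RintegralZ {R : realType} (D : set R) (f : R -> R) (v c : R) :
  measurable D -> has_Rintegral D f v ->
  has_Rintegral D (fun s => c * f s) (c * v).
Proof.
move=> mD [fi fv]; split; last by rewrite RintegralZl// fv.
under [X in integrable _ _ X]eq_fun do rewrite /= EFinM.
exact: integrableZl.
Qed.

Lemma has_Rintegral_sum {R : realType} (D : set R) (I : finType)
    (f : I -> R -> R) (v : I -> R) :
  measurable D -> (forall i, has_Rintegral D (f i) (v i)) ->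
  has_Rintegral D (fun s => \sum_i f i s) (\sum_i v i).
Proof.
move=> mD H.
have -> : (fun s => \sum_i f i s) = \sum_i f i.
  by apply/funext => s; rewrite fct_sumE.
elim/big_ind2 : _ => [|g a h b|//]; last exact: has_RintegralD.
split; first exact: integrable0.
by rewrite Rintegral_cst// mul0r.
Qed.

(** The step cuts the domain down to [[c, L]], where the fundamental theorem of calculus applies.
    With polynomials, checking the primitive is a formal derivative computation. *)
Lemma has_Rintegral_step_horner {R : realType} (c L : R) (p P : {poly R}) :
  0 <= c -> c <= L -> P^`() = p ->
  has_Rintegral `[0, L] (fun s : R => (c <= s)%R%:R * p.[s]) (P.[L] - P.[c]).
Proof.
move=> c0 cL dP.
have E : {in `[0, L]%classic,
    (fun s : R => (c <= s)%R%:R * p.[s]) =1 (horner p \_ `[c, L])}.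
  move=> s; rewrite inE /= in_itv /= => /andP[s0 sL].
  rewrite patchE mem_setE in_itv /= sL andbT.
  by case: (c <= s)%R; rewrite ?mul1r ?mul0r.
have cp : {within `[c, L], continuous (horner p)}.
  by apply: continuous_subspaceT => s; exact: continuous_horner.
have sub : `[0, L]%classic `&` `[c, L]%classic = `[c, L]%classic :> set R.
  apply/setIidPr => s /=; rewrite !in_itv /= => /andP[cs ->].
  by rewrite (le_trans c0 cs).
have ip : lebesgue_measure.-integrable `[c, L] (EFin \o horner p).
  by apply: continuous_compact_integrable => //; exact: segment_compact.
split.
  have mI : measurable (`[0, L]%classic : set (measurableTypeR R)).
    exact: measurable_itv.
  refine (eq_integrable mI (EFin \o (horner p \_ `[c, L]%classic)) _ _ _).
  - by move=> s sL; rewrite /= E.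
  - rewrite -restrict_EFin.
    apply/integrable_restrict; try exact: measurable_itv.
    by rewrite sub.
transitivity (\int[lebesgue_measure]_(s in `[0, L]) (horner p \_ `[c, L]) s).
  exact: eq_Rintegral.
rewrite -Rintegral_mkcondr sub.
(* The fundamental theorem needs [c < L]; for [c = L] the domain is a single point. *)
move: cL; rewrite le_eqVlt => /predU1P[<-|cL].
  by rewrite set_itv1 Rintegral_set1 subrr.
rewrite /Rintegral (continuous_FTC2 (F := horner P) cL cp) //.
- split; first by move=> s _; exact: derivable_horner.
  + by apply: cvg_at_right_filter; exact: continuous_horner.
  + by apply: cvg_at_left_filter; exact: continuous_horner.
- by move=> s _; rewrite -dP derivE.
Qed.

Lemma has_Rintegral_step {R : realType} (c L : R) (p P : {poly R})
    (f F : R -> R) :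
  0 <= c <= L -> P^`() = p -> horner p =1 f -> horner P =1 F ->
  has_Rintegral `[0, L] (fun s => (c <= s)%R%:R * f s) (F L - F c).
Proof.
move=> /andP[c0 cL] dP /funext <- /funext <-.
exact: has_Rintegral_step_horner.
Qed.

(** In the expanded square, a product of two steps is the step at the larger threshold, which is
    where the maximum comes from. *)
Lemma Rintegral_sqr_count_err {R : realType} (N : nat) (I : finType)
    (d : I -> R) :
  (0 < N)%N -> (forall i, 0 <= d i <= 2^-1) ->
  \int[lebesgue_measure]_(s in `[0, N%:R / 2])
    (N%:R^-1 * (\sum_i (N%:R * d i <= s)%R%:R) - (1 + 2 * s)) ^+ 2
  = N%:R ^- 2 * \sum_i \sum_j (N%:R / 2 - N%:R * Num.max (d i) (d j))
    - 2 / N%:R * \sum_i (N%:R / 2 + (N%:R / 2) ^+ 2 -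
                          (N%:R * d i + (N%:R * d i) ^+ 2))
    + (N%:R / 2 + 2 * (N%:R / 2) ^+ 2 + 4 / 3 * (N%:R / 2) ^+ 3) :> R.
Proof.
move=> N0 d01; set L : R := N%:R / 2.
have NR : 0 < N%:R :> R by rewrite ltr0n.
have mI : measurable (`[0, L]%classic : set (measurableTypeR R)).
  exact: measurable_itv.
have Ndi i : 0 <= N%:R * d i <= L.
  have /andP[d0 d1] := d01 i.
  rewrite mulr_ge0 ?(ltW NR)//=.
  by rewrite /L ler_pM2l.
have h1 c : 0 <= c <= L ->
    has_Rintegral `[0, L] (fun s => (c <= s)%R%:R * 1) (L - c).
  move=> cL; apply: (has_Rintegral_step c L 1 'X (fun=> 1) id) => // [|s|s].
  - exact: derivX.
  - exact: hornerC.
  - exact: hornerX.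
have h2 c : 0 <= c <= L ->
    has_Rintegral `[0, L] (fun s => (c <= s)%R%:R * (1 + 2 * s))
      (L + L ^+ 2 - (c + c ^+ 2)).
  move=> cL.
  apply: (has_Rintegral_step c L (1 + 2%:P * 'X) ('X + 'X ^+ 2) _
    (fun s => s + s ^+ 2)) => // [|s|s].
  - by rewrite derivD derivX derivXn /= expr1 mul_polyC scaler_nat.
  - by rewrite !hornerE.
  - by rewrite !hornerE.
(* The step at 0 is identically 1 on the domain; it brings the pure polynomial term under the same
   rule. *)
have h3 : has_Rintegral `[0, L] (fun s => (0 <= s)%R%:R * (1 + 2 * s) ^+ 2)
    (L + 2 * L ^+ 2 + 4 / 3 * L ^+ 3).
  rewrite (_ : L + _ + _ = L + 2 * L ^+ 2 + 4 / 3 * L ^+ 3 -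
    (0 + 2 * 0 ^+ 2 + 4 / 3 * 0 ^+ 3)); last first.
    by rewrite !expr0n !mulr0 !addr0 subr0.
  apply: (has_Rintegral_step 0 L ((1 + 2%:P * 'X) ^+ 2)
    ('X + 2%:P * 'X ^+ 2 + (4 / 3)%:P * 'X ^+ 3) _
    (fun s => s + 2 * s ^+ 2 + 4 / 3 * s ^+ 3)) => // [||s|s].
  - by rewrite lexx divr_ge0 ?ltW.
  - rewrite !mul_polyC !derivD !derivZ !derivXn derivX /= expr1.
    rewrite -!scalerMnr !scalerMnl -!mul_polyC.
    rewrite (_ : (4 *+ 3) *: 3^-1 = 4 :> R); last first.
      by rewrite /GRing.scale/= -mulr_natr; field.
    rewrite (_ : 2 *+ 2 = 4 :> R); last by rewrite -mulr_natr -natrM.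
    rewrite !polyC_natr.
    ring.
  - by rewrite !hornerE.
  - by rewrite !hornerE.
have H : has_Rintegral `[0, L] (fun s =>
   N%:R ^- 2 * (\sum_i \sum_j
      (Num.max (N%:R * d i) (N%:R * d j) <= s)%R%:R * 1)
   + ((- (2 / N%:R)) * (\sum_i ((N%:R * d i <= s)%R%:R * (1 + 2 * s)))
      + (0 <= s)%R%:R * (1 + 2 * s) ^+ 2))
   (N%:R ^- 2 * (\sum_i \sum_j (L - Num.max (N%:R * d i) (N%:R * d j)))
   + ((- (2 / N%:R)) *
        (\sum_i (L + L ^+ 2 - (N%:R * d i + (N%:R * d i) ^+ 2)))
      + (L + 2 * L ^+ 2 + 4 / 3 * L ^+ 3))).
  apply: has_RintegralD => //; first apply: has_RintegralZ => //.
    apply: has_Rintegral_sum => // i; apply: has_Rintegral_sum => // j.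
    apply: h1; have /andP[a1 a2] := Ndi i; have /andP[b1 b2] := Ndi j.
    by rewrite le_max a1 ge_max a2 b2.
  apply: has_RintegralD => //; apply: has_RintegralZ => //.
  by apply: has_Rintegral_sum => // i; apply: h2.
have [_ HV] := H.
rewrite mulNr addrA in HV.
under eq_bigr do under eq_bigr do rewrite maxr_pMr ?ler0n//.
rewrite -{}HV; apply: eq_Rintegral => s.
rewrite inE /= in_itv /= => /andP[s0 _].
rewrite s0 mul1r -[\sum_i (_ * (1 + _))]mulr_suml.
have -> : \sum_i \sum_j (Num.max (N%:R * d i) (N%:R * d j) <= s)%R%:R * 1 =
    (\sum_i (N%:R * d i <= s)%R%:R) ^+ 2 :> R.
  rewrite expr2 mulr_suml; apply: eq_bigr => i _; rewrite mulr_sumr.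
  by apply: eq_bigr => j _; rewrite ge_max mulr1 -natrM mulnb.
by field; rewrite gt_eqF.
Qed.

(** * Torus norm and Fourier expansions of the kernels *)

(** A nonzero integer is at distance at least [1 - |r| >= 1/2] from [r], so 0 is a nearest
    integer. *)
Lemma dist_int_small {R : realType} (r : R) : `|r| <= 2^-1 -> dist_int r = `|r|.
Proof.
move=> r2; apply/eqP; rewrite eq_le; apply/andP; split.
  apply: ge_inf; first by exists 0 => _ [k _ <-]; exact: normr_ge0.
  by exists 0 => //; rewrite subr0.
apply: lb_le_inf; first by exists `|r|; exists 0 => //; rewrite subr0.
move=> _ [k _ <-]; have [->|k0] := eqVneq k 0; first by rewrite subr0.
have : 1 <= `|k%:~R : R|.
  by rewrite -intr_norm -[1]/(1%:~R) ler_int -gtz0_ge1 normr_gt0.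
have := ler_normB r (r - k%:~R); rewrite opprB addrC subrK; lra.
Qed.

(** The norm is [|r - m|] for the nearest integer [m]; cosine ignores the shift by periodicity and
    the sign by parity. *)
Lemma tnorm_cos {R : realType} (z : torus R) : 0 <= tnorm z <= 2^-1 /\
  forall k : nat, cos (2 * pi * k%:R * repr z) = cos (2 * pi * k%:R * tnorm z).
Proof.
set r := repr z; pose m := Num.floor (r + 2^-1).
have rm : `|r - m%:~R| <= 2^-1.
  have m1 := ge_floor (r + 2^-1); have := lt_succ_floor (r + 2^-1).
  rewrite intrD -/m ler_norml => m2; move: m1; rewrite -/m => m1; lra.
have -> : tnorm z = `|r - m%:~R|.
  by rewrite /tnorm -/r -[r in LHS](subrK m%:~R) dist_intDz dist_int_small.
split; first by rewrite normr_ge0.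
move=> k; set u := r - m%:~R.
have -> : cos (2 * pi * k%:R * `|u|) = cos (2 * pi * k%:R * u).
  by case: (ger0P u) => // _; rewrite mulrN cosN.
rewrite -[in LHS](subrK m%:~R r) -/u.
have -> : 2 * pi * k%:R * (u + m%:~R) =
          2 * pi * k%:R * u + (pi *+ 2) * (k%:Z * m)%:~R :> R.
  by rewrite mulrDr intrM -pmulrn -[pi *+ 2]mulr_natl !mulrA.
by rewrite (periodicz (@cosD2pi R)).
Qed.

Lemma cvg_fin_sum {R : realType} (I : finType) (u : I -> R^nat) (l : I -> R) :
  (forall i, u i n @[n --> \oo] --> l i) ->
  (\sum_i u i n) @[n --> \oo] --> \sum_i l i.
Proof.
move=> H.
rewrite (_ : (fun n => \sum_i u i n) = \sum_i u i); last first.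
  by apply/funext => n; rewrite fct_sumE.
elim/big_ind2 : _ => [|f a g b|i _]; [exact: cvg_cst | exact: cvgD | exact: H].
Qed.

Lemma cvg_cos_series {R : realType} (t : R) : 0 <= t -> t <= 2 * pi ->
  cos_series t n @[n --> \oo] --> (t - pi) ^+ 2 / 4 - pi ^+ 2 / 12.
Proof.
by move=> t0 t2; rewrite -limn_cos_series//; exact: is_cvg_cos_series.
Qed.

(** Product-to-sum reduces to the cosine series at [2 pi (a + b)] and [2 pi (a - b)]. Taking
    [b <= a] puts both in the range of the closed form; the terms linear in [b] cancel and those in
    [a] leave the maximum. *)
Lemma cvg_cos_prod_series {R : realType} (a b : R) :
  0 <= a <= 2^-1 -> 0 <= b <= 2^-1 ->
  \sum_(k < n) (k.+1%:R ^- 2 *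
      (cos (2 * pi * k.+1%:R * a) * cos (2 * pi * k.+1%:R * b)))
    @[n --> \oo] --> pi ^+ 2 * (6^-1 - Num.max a b + a ^+ 2 + b ^+ 2).
Proof.
wlog ab : a b / b <= a.
  move=> W a2 b2; case/orP: (le_total b a) => [ba|ab]; first exact: W.
  have := W b a ab b2 a2.
  rewrite maxC -!addrA [X in _ + (_ + X)]addrC.
  by under eq_fun do under eq_bigr do rewrite [X in _ * X]mulrC.
move=> /andP[a0 a2] /andP[b0 b2]; have p0 := pi_gt0 R.
have p1 : 2 * pi * (a + b) <= 2 * pi by rewrite ger_pMr; lra.
have p2 : 2 * pi * (a - b) <= 2 * pi by rewrite ger_pMr; lra.
have p3 : 0 <= 2 * pi * (a + b) by rewrite mulr_ge0; lra.
have p4 : 0 <= 2 * pi * (a - b) by rewrite mulr_ge0; lra.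
rewrite (_ : (fun n => \sum_(k < n) _) = (fun n =>
  (cos_series (2 * pi * (a + b)) n + cos_series (2 * pi * (a - b)) n) * 2^-1)).
  rewrite max_l// (_ : pi ^+ 2 * _ =
    ((2 * pi * (a + b) - pi) ^+ 2 / 4 - pi ^+ 2 / 12 +
    ((2 * pi * (a - b) - pi) ^+ 2 / 4 - pi ^+ 2 / 12)) * 2^-1); last by field.
  by apply: cvgMl; apply: cvgD; exact: cvg_cos_series.
apply/funext => n; apply/esym.
rewrite /cos_series /series /= !big_mkord -big_split mulr_suml /=.
apply: eq_bigr => k _; set v := k.+1%:R; rewrite -mulrDr -mulrA; congr (_ * _).
have -> : v * (2 * pi * (a + b)) = 2 * pi * v * a + 2 * pi * v * b by ring.
have -> : v * (2 * pi * (a - b)) = 2 * pi * v * a - 2 * pi * v * b by ring.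
by rewrite cosD cosB; field.
Qed.

(** This is the cosine series at [2 pi a] minus that at [2 pi a + pi]: the quadratic parts cancel,
    and the coefficients are 0 for even and positive for odd frequencies. *)
Lemma cvg_cos_odd_series {R : realType} (a : R) : 0 <= a <= 2^-1 ->
  \sum_(k < n) (k.+1%:R ^- 2 * (1 - (-1) ^+ k.+1) * cos (2 * pi * k.+1%:R * a))
    @[n --> \oo] --> pi ^+ 2 * (4^-1 - a).
Proof.
move=> /andP[a0 a2]; have p0 := pi_gt0 R.
have p1 : 2 * pi * a <= pi by rewrite mulrAC ger_pMl; lra.
have p3 : 0 <= 2 * pi * a by rewrite mulr_ge0; lra.
have l1 : 2 * pi * a <= 2 * pi by lra.
have l2 : 2 * pi * a + pi <= 2 * pi by lra.
have l3 : 0 <= 2 * pi * a + pi by lra.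
rewrite (_ : (fun n => \sum_(k < n) _) = (fun n =>
  cos_series (2 * pi * a) n - cos_series (2 * pi * a + pi) n)).
  rewrite (_ : pi ^+ 2 * _ = (2 * pi * a - pi) ^+ 2 / 4 - pi ^+ 2 / 12 -
    ((2 * pi * a + pi - pi) ^+ 2 / 4 - pi ^+ 2 / 12)); last by field.
  by apply: cvgB; exact: cvg_cos_series.
apply/funext => n; apply/esym.
rewrite /cos_series /series /= !big_mkord -sumrB.
apply: eq_bigr => k _; rewrite [_ * (_ + pi)]mulrDr cosDnatpi.
have -> : k.+1%:R * (2 * pi * a) = 2 * pi * k.+1%:R * a by ring.
ring.
Qed.

(** * Exponential sums, diaphony and mean distance *)

Lemma normc_sum_echar {R : realType} (I : finType) (y : I -> torus R)
    (k : nat) :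
  Normc.normc (\sum_i echar k (y i)) ^+ 2 =
  (\sum_i cos (2 * pi * k%:R * repr (y i))) ^+ 2 +
  (\sum_i sin (2 * pi * k%:R * repr (y i))) ^+ 2.
Proof.
have -> : \sum_i echar k (y i) = ((\sum_i cos (2 * pi * k%:R * repr (y i))) +i*
    (\sum_i sin (2 * pi * k%:R * repr (y i))))%C.
  elim/big_rec3 : _ => // i u v w _ ->.
  by [].
by rewrite /Normc.normc sqr_sqrtr// addr_ge0 ?sqr_ge0.
Qed.

(** The loss consists of the squared sine sums; the squared cosine sums, expanded over pairs, give
    the kernel exactly. *)
Lemma diaphony_ge {R : realType} (I : finType) (y : I -> torus R) :
  2 * pi ^+ 2 * \sum_i \sum_j (6^-1 - Num.max (tnorm (y i)) (tnorm (y j)) +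
    tnorm (y i) ^+ 2 + tnorm (y j) ^+ 2) <= diaphony y ^+ 2.
Proof.
pose u k : R := k.+1%:R ^- 2 * Normc.normc (\sum_i echar k.+1 (y i)) ^+ 2.
have u0 k : 0 <= u k by rewrite mulr_ge0 ?invr_ge0 ?sqr_ge0.
have cu : cvgn (series u).
  pose B : R := #|I|%:R ^+ 2 + #|I|%:R ^+ 2.
  apply: (@series_le_cvg _ _ (fun k => B * k.+1%:R ^- 2)) => //.
  - by move=> k; rewrite mulr_ge0 ?addr_ge0 ?invr_ge0 ?sqr_ge0.
  - move=> k; rewrite /u mulrC ler_wpM2r ?invr_ge0 ?sqr_ge0// normc_sum_echar.
    have bnd (f : R -> R) : (forall t, `|f t| <= 1) ->
        (\sum_i f (2 * pi * k.+1%:R * repr (y i))) ^+ 2 <= #|I|%:R ^+ 2.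
      move=> f1; rewrite -[leLHS]real_normK ?num_real// lerXn2r ?nnegrE//.
      apply: le_trans (ler_norm_sum _ _ _) _.
      apply: le_trans (ler_sum _ _) _; first by move=> i _; exact: f1.
      by rewrite sumr_const.
    rewrite lerD// bnd// => t; rewrite ler_norml ?cos_geN1 ?cos_le1//.
    by rewrite sin_geN1 sin_le1.
  - exact: is_cvg_seriesZ is_cvg_inv_sqr.
have dE : diaphony y ^+ 2 = 2 * limn (series u).
  rewrite /diaphony.
  have -> : limn (fun n => \sum_(1 <= k < n) (k%:R ^- 2 *
      Normc.normc (\sum_(j : I) echar k (y j)) ^+ 2)) = limn (series u).
    apply/cvg_lim => //.
    (* The sum in [diaphony] starts at frequency 1, whereas [u] is indexed from 0. *)
    rewrite -cvg_shiftS.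
    by under eq_fun do rewrite big_add1 /=; exact: cu.
  rewrite sqr_sqrtr// mulr_ge0//; apply: (limr_ge cu).
  by apply: nearW => n; rewrite /series/= sumr_ge0.
rewrite dE -mulrA ler_pM2l//.
have cl : (\sum_i \sum_j \sum_(k < n) (k.+1%:R ^- 2 *
    (cos (2 * pi * k.+1%:R * tnorm (y i)) *
     cos (2 * pi * k.+1%:R * tnorm (y j))))) @[n --> \oo] -->
  \sum_i \sum_j pi ^+ 2 * (6^-1 - Num.max (tnorm (y i)) (tnorm (y j)) +
    tnorm (y i) ^+ 2 + tnorm (y j) ^+ 2).
  apply: cvg_fin_sum => i; apply: cvg_fin_sum => j.
  apply: cvg_cos_prod_series; first by have [] := tnorm_cos (y i).
  by have [] := tnorm_cos (y j).
rewrite mulr_sumr; under eq_bigr do rewrite mulr_sumr.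
rewrite -(cvg_lim _ cl)//; apply: ler_lim => //.
  by apply/cvg_ex; eexists; exact: cl.
apply: nearW => n.
rewrite /series /= big_mkord.
(* With the frequency outermost, the two partial sums are compared term by term. *)
under eq_bigr do rewrite exchange_big /=.
rewrite exchange_big; apply: ler_sum => k _ /=.
rewrite /u normc_sum_echar.
have -> : \sum_i cos (2 * pi * k.+1%:R * repr (y i)) =
    \sum_i cos (2 * pi * k.+1%:R * tnorm (y i)).
  by apply: eq_bigr => i _; have [_ ->] := tnorm_cos (y i).
under eq_bigr do rewrite -mulr_sumr -mulr_sumr.
rewrite -mulr_sumr ler_pM2l ?invr_gt0 ?exprn_gt0//.
by rewrite -mulr_suml -expr2 lerDl sqr_ge0.
Qed.

(** Expanding [cos(c_i - c_j)] turns the sum into a squared cosine sum plus a squared sine sum. *)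
Lemma sum_cos_tnorm_sub_ge0 {R : realType} (I : finType) (x : I -> torus R)
    (k : nat) :
  0 <= \sum_(p : I * I) cos (2 * pi * k%:R * tnorm (x p.1 - x p.2)).
Proof.
pose c i := 2 * pi * k%:R * repr (x i).
have -> : \sum_(p : I * I) cos (2 * pi * k%:R * tnorm (x p.1 - x p.2)) =
    \sum_i \sum_j (cos (c i) * cos (c j) + sin (c i) * sin (c j)).
  rewrite pair_bigA /=; apply: eq_bigr => -[i j] _ /=; rewrite -cosB -mulrBr.
  have [_ <-] := tnorm_cos (x i - x j).
  (* The representative of a difference may differ from the difference of representatives by an
     integer, which [echar] does not see. *)
  have := echar_pi k (repr (x i) - repr (x j)).
  by rewrite torus_piB !reprK /echar /expi => -[].
under eq_bigr do rewrite big_split /= -!mulr_sumr.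
by rewrite big_split /= -!mulr_suml -!expr2 addr_ge0 ?sqr_ge0.
Qed.

Lemma sum_tnorm_sub_le {R : realType} (I : finType) (x : I -> torus R) :
  \sum_(p : I * I) tnorm (x p.1 - x p.2) <= #|I|%:R ^+ 2 / 4.
Proof.
have p0 := pi_gt0 R.
have cl : (\sum_(p : I * I) \sum_(k < n) (k.+1%:R ^- 2 * (1 - (-1) ^+ k.+1) *
    cos (2 * pi * k.+1%:R * tnorm (x p.1 - x p.2)))) @[n --> \oo] -->
    \sum_(p : I * I) pi ^+ 2 * (4^-1 - tnorm (x p.1 - x p.2)).
  apply: cvg_fin_sum => p; apply: cvg_cos_odd_series.
  by have [] := tnorm_cos (x p.1 - x p.2).
have : 0 <= \sum_(p : I * I) pi ^+ 2 * (4^-1 - tnorm (x p.1 - x p.2)).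
  rewrite -(cvg_lim _ cl)//; apply: limr_ge.
    by apply/cvg_ex; eexists; exact: cl.
  apply: nearW => n; rewrite exchange_big /= sumr_ge0// => k _.
  rewrite -mulr_sumr mulr_ge0 ?sum_cos_tnorm_sub_ge0//.
  rewrite mulr_ge0 ?invr_ge0 ?sqr_ge0//.
  by rewrite subr_ge0 -signr_odd; case: odd; rewrite ?expr0 ?expr1//; lra.
rewrite -mulr_sumr pmulr_rge0 ?exprn_gt0// sumrB sumr_const card_prod.
by rewrite -[4^-1 *+ _]mulr_natl natrM subr_ge0 expr2.
Qed.

Lemma tnorm0 {R : realType} : tnorm (0 : torus R) = 0.
Proof.
rewrite -(subrr (\pi_(torus R)%qT (0 : R))) -torus_piB tnorm_pi subrr.
by rewrite dist_int_small normr0 ?invr_ge0.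
Qed.

(** The hypothesis puts every diagonal pair under the threshold, so discarding them removes exactly
    [N]. *)
Lemma card_offdiag_le {R : realType} (N : nat) (d : 'I_N * 'I_N -> R) (t : R) :
  (forall p, p.1 == p.2 -> d p <= t) ->
  #|[set p : 'I_N * 'I_N | (p.1 != p.2) && (d p <= t)]%SET|%:R =
  \sum_p (d p <= t)%R%:R - N%:R :> R.
Proof.
move=> dt.
have -> : N%:R = \sum_(p : 'I_N * 'I_N) (p.1 == p.2)%:R :> R.
  rewrite -(pair_bigA _ (fun i j => (i == j)%:R : R)) /=.
  transitivity (\sum_(i < N) (1 : R)); first by rewrite sumr_const card_ord.
  apply: eq_bigr => i _; rewrite (bigD1 i)//= eqxx big1 ?addr0// => j /negPf.
  by rewrite eq_sym => ->.
rewrite -sumrB cardsE -sum1_card natr_sum big_mkcond /=; apply: eq_bigr => p _.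
rewrite unfold_in /=; case: (boolP (_ == _)) => [/dt ->|_] /=.
  by rewrite subrr.
by rewrite subr0; case: ifP.
Qed.

(** * Comparison of the integral with the diaphony *)

Theorem mainTheorem4 (R : realType) (N : nat) (hN : (1 <= N)%N)
    (x : 'I_N -> torus R) :
  2 / N%:R *
    (\int[lebesgue_measure]_(s in `[0, N%:R / 2])
       `| N%:R^-1 *
            #|[set p : 'I_N * 'I_N |
                 (p.1 != p.2) && (tnorm (x p.1 - x p.2) <= s / N%:R)]%SET|%:R
          - 2 * s | ^+ 2)
  <= pi ^- 2 *
       diaphony (fun p : 'I_N * 'I_N => x p.1 - x p.2) ^+ 2 + 1.
Proof.
have NR : 0 < N%:R :> R by rewrite ltr0n.
pose d (p : 'I_N * 'I_N) : R := tnorm (x p.1 - x p.2).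
have d01 p : 0 <= d p <= 2^-1 by have [] := tnorm_cos (x p.1 - x p.2).
(* Restoring the [N] diagonal pairs adds 1 to the normalized count, hence [1 + 2 * s]. *)
have -> : \int[lebesgue_measure]_(s in `[0, N%:R / 2])
     `| N%:R^-1 * #|[set p : 'I_N * 'I_N |
                 (p.1 != p.2) && (tnorm (x p.1 - x p.2) <= s / N%:R)]%SET|%:R
          - 2 * s | ^+ 2 =
  \int[lebesgue_measure]_(s in `[0, N%:R / 2])
    (N%:R^-1 * (\sum_p (N%:R * d p <= s)%R%:R) - (1 + 2 * s)) ^+ 2 :> R.
  apply: eq_Rintegral => s; rewrite inE /= in_itv /= => /andP[s0 _].
  rewrite real_normK ?num_real// (card_offdiag_le N d) => [|p /eqP p12].
    have -> : \sum_p (d p <= s / N%:R)%R%:R =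
        \sum_p (N%:R * d p <= s)%R%:R :> R.
      by apply: eq_bigr => p _; rewrite ler_pdivlMr// mulrC.
    congr (_ ^+ 2).
    by rewrite mulrBr mulVf ?gt_eqF//; ring.
  by rewrite /d p12 subrr tnorm0 divr_ge0.
rewrite Rintegral_sqr_count_err//.
have : 2 * pi ^+ 2 *
    \sum_p \sum_q (6^-1 - Num.max (d p) (d q) + d p ^+ 2 + d q ^+ 2) <=
  diaphony (fun p : 'I_N * 'I_N => x p.1 - x p.2) ^+ 2 := diaphony_ge _ _.
have := sum_tnorm_sub_le _ x; rewrite card_ord.
set F := diaphony _ ^+ 2.
have F0 : 0 <= F by exact: sqr_ge0.
rewrite -[\sum_(p : _ * _) tnorm _]/(\sum_p d p).
set S := \sum_p d p; set M := \sum_p \sum_q Num.max (d p) (d q).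
set Q := \sum_p d p ^+ 2.
have card2 : #|{: 'I_N * 'I_N}|%:R = N%:R ^+ 2 :> R.
  by rewrite card_prod card_ord natrM expr2.
have sumc (c : R) : \sum_(p : 'I_N * 'I_N) c = N%:R ^+ 2 * c.
  by rewrite sumr_const -card2 mulr_natl.
have -> : \sum_p \sum_q (6^-1 - Num.max (d p) (d q) + d p ^+ 2 + d q ^+ 2) =
    N%:R ^+ 4 / 6 - M + 2 * N%:R ^+ 2 * Q :> R.
  under eq_bigr do rewrite !big_split /= sumrN !sumc.
  rewrite !big_split /= sumrN !sumc -mulr_sumr -/M -/Q; ring.
have -> : \sum_p \sum_q (N%:R / 2 - N%:R * Num.max (d p) (d q)) =
    N%:R ^+ 5 / 2 - N%:R * M :> R.
  under eq_bigr do rewrite big_split /= sumrN sumc -mulr_sumr.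
  rewrite big_split /= sumrN sumc -mulr_sumr -/M; ring.
have -> : \sum_p (N%:R / 2 + (N%:R / 2) ^+ 2 -
                   (N%:R * d p + (N%:R * d p) ^+ 2)) =
    N%:R ^+ 3 / 2 + N%:R ^+ 4 / 4 - N%:R * S - N%:R ^+ 2 * Q :> R.
  rewrite big_split /= sumrN sumc big_split /= -mulr_sumr -/S.
  under eq_bigr do rewrite exprMn.
  by rewrite -mulr_sumr -/Q; field.
move: S M Q F F0 => S M Q F F0 HS HF.
have n1 : 1 <= N%:R :> R by rewrite ler1n.
move: (N%:R : R) NR n1 HS HF {card2 sumc} => n NR n1 HS HF.
(* [W] is the double sum of the kernel, so [HF] bounds it by the diaphony. *)
pose W := n ^+ 4 / 6 - M + 2 * n ^+ 2 * Q.
have p2 : 0 < pi ^+ 2 :> R by rewrite exprn_gt0 ?pi_gt0.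
set G := pi ^- 2 * F.
have G0 : 0 <= G by rewrite mulr_ge0 ?invr_ge0 ?(ltW p2).
have WG : 2 * W <= G by rewrite /G ler_pdivlMl// mulrCA mulrA.
rewrite [leLHS](_ : _ = 2 * W / n ^+ 2 - 4 / n * (n ^+ 2 / 4 - S) + 1); last first.
  by rewrite /W; field; rewrite gt_eqF.
(* By [HS] the mean distance is at most 1/4, so the subtracted term is nonnegative. *)
rewrite lerD2r; apply: (@le_trans _ _ (2 * W / n ^+ 2)).
  by rewrite gerBl mulr_ge0 ?subr_ge0// divr_ge0 ?ltW.
(* The factor [n ^- 2] is given away here, using [n >= 1] and [G >= 0]. *)
rewrite ler_pdivrMr ?exprn_gt0//; apply: le_trans WG _.
by rewrite ler_peMr// -[leLHS](expr1n _ 2) lerXn2r ?nnegrE// ltW.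
Qed.
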